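(* Let $a\in\mathbb R$, $b\in\mathbb R\setminus\{0\}$, $c=-\frac{1+a^2}{b}$, and let $J=J_{a,b}$ be the left-invariant complex structure on $G=\mathrm U(2)$ given by $$Je_0=ae_0+be_1,\quad Je_1=ce_0-ae_1,\quad Je_2=-e_3,\quad Je_3=e_2 .$$ (i) If $(a,b)\neq(0,1)$ then, up to scale, there is a unique left-invariant locally conformally symplectic (lcs) structure $\omega$ on $\mathrm U(2)$ such that $(\omega,J)$ is locally conformally pseudo-Kähler. It is given by $\omega=e^0\wedge e^1+e^2\wedge e^3$. All these structures are of Vaisman type. The locally conformally pseudo-Kähler metric $g=-\omega\circ J$ is definite if and only if $b<0$. (ii) If $(a,b)=(0,1)$ then $(\omega,J)$ is locally conformally pseudo-Kähler for every left-invariant lcs structure $\omega$ on $\mathrm U(2)$. The metric is always indefinite, and the structure $(\omega,J)$ is of Vaisman type if and only if $\omega$ is proportional to $e^0\wedge e^1+e^2\wedge e^3$.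
   Context: $\mathfrak u(2)=\mathbb R e_0\oplus\mathfrak{su}(2)$, where $e_0\neq0$ spans the center and $(e_1,e_2,e_3)$ is a basis of $\mathfrak{su}(2)$ with $[e_\alpha,e_\beta]=-e_\gamma$ for every cyclic permutation $(\alpha,\beta,\gamma)$ of $(1,2,3)$; $(e^0,e^1,e^2,e^3)$ is the dual basis of $\mathfrak u(2)^*$. Left-invariant tensors on $\mathrm U(2)$ are identified with tensors on $\mathfrak u(2)$. An lcs structure is a non-degenerate $2$-form $\omega$ with $d\omega=\lambda\wedge\omega$ for some closed $1$-form $\lambda$ (the Lee form). $(\omega,J)$ is locally conformally pseudo-Kähler if $\omega$ is an lcs structure and $J$ is an integrable complex structure skew-symmetric with respect to $\omega$; the associated, possibly indefinite, metric is $g=\omega(\cdot,J\cdot)=-\omega(J\cdot,\cdot)$, also written $-\omega\circ J$. The Lee field $\xi$ is defined by $g(\xi,\cdot)=-\frac12\lambda$. The structure is of Vaisman type if $\xi$ is a parallel unit vector field for the Levi-Civita connection of $g$, where the unit length is understood as a normalization that can be achieved by rescaling $\omega$ by a constant.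
   Formalization: The lcs structures considered are those whose Lee form is −e^0 (e_0 normalized by ω); without this, e^0∧e^1+s e^2∧e^3 for every s≠0 is also lcs and compatible with J_{a,b}, so uniqueness in (i) fails, and (ii) fails too. *)

(* Defs.v *)
From HB Require Import structures.
From mathcomp Require Import all_boot all_order all_algebra.
From mathcomp Require Import complex reals.

Set Implicit Arguments.
Unset Strict Implicit.
Unset Printing Implicit Defensive.

Import Order.TTheory GRing.Theory Num.Theory.
Local Open Scope ring_scope.

Section LieAlgebraU2.
Variable R : realType.
Local Notation C := R[i].

Definition skew_hermitian : {pred 'M[C]_2} := [pred A | map_mx conjc A^T == - A].

Fact skew_hermitian_zmod : zmod_closed skew_hermitian.
Proof.
split=> [|A B /eqP sA /eqP sB]; rewrite inE.
  by rewrite trmx0 map_mx0 oppr0.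
by rewrite raddfB map_mxB /= sA sB opprB opprK addrC.
Qed.
HB.instance Definition _ :=
  GRing.isZmodClosed.Build 'M[C]_2 skew_hermitian skew_hermitian_zmod.

Record u2 := U2 { u2val :> 'M[C]_2; _ : u2val \in skew_hermitian }.
HB.instance Definition _ := [isSub of u2 for u2val].
HB.instance Definition _ := [Choice of u2 by <:].
HB.instance Definition _ := [SubChoice_isSubZmodule of u2 by <:].

Fact u2_scale_subproof (r : R) (A : u2) :
  (r%:C)%C *: (A : 'M[C]_2) \in skew_hermitian.
Proof.
case: A => A /= /eqP sA; rewrite inE; apply/eqP.
rewrite linearZ /= map_mxZ /= sA scalerN.
by congr (- (_ *: _)); rewrite oppr0.
Qed.
Definition u2_scale r A : u2 := U2 (u2_scale_subproof r A).

Fact u2_scaleA r s A : u2_scale r (u2_scale s A) = u2_scale (r * s) A.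
Proof. by apply: val_inj; rewrite /= scalerA rmorphM. Qed.
Fact u2_scale1 : left_id 1 u2_scale.
Proof. by move=> A; apply: val_inj; rewrite /= scale1r. Qed.
Fact u2_scaleDr : right_distributive u2_scale +%R.
Proof. by move=> r A B; apply: val_inj; rewrite /= scalerDr. Qed.
Fact u2_scaleDl A : {morph u2_scale^~ A : r s / r + s}.
Proof. by move=> r s; apply: val_inj; rewrite /= rmorphD scalerDl. Qed.
HB.instance Definition _ :=
  GRing.Zmodule_isLmodule.Build R u2 u2_scaleA u2_scale1 u2_scaleDr u2_scaleDl.

Definition u2_coord (A : u2) : 'rV[R]_4 :=
  \row_i [:: complex.Im (u2val A 0 0); complex.Im (u2val A 1 1);
             complex.Re (u2val A 0 1); complex.Im (u2val A 0 1)]`_i.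

Definition u2_mx (v : 'rV[R]_4) : 'M[C]_2 :=
  \matrix_(i, j) if i == 0 then
       if j == 0 then Complex 0 (v 0 0) else Complex (v 0 2%:R) (v 0 3%:R)
     else if j == 0 then Complex (- v 0 2%:R) (v 0 3%:R) else Complex 0 (v 0 1).

Fact u2_mx_skew v : u2_mx v \in skew_hermitian.
Proof.
rewrite inE; apply/eqP/matrixP => i j; rewrite !mxE.
by case: (i == 0); case: (j == 0); apply/eqP; rewrite eq_complex /= ?oppr0 ?opprK ?eqxx.
Qed.

Fact u2_coord_linear : linear u2_coord.
Proof.
move=> r [A sA] [B sB]; apply/rowP => i; rewrite !mxE.
by case: i => -[|[|[|[|//]]]] ? /=; case: (A _ _) => p q; case: (B _ _) => p' q';
  rewrite /= ?mul0r ?subr0 ?addr0.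
Qed.

Lemma ord2_cases (P : 'I_2 -> Prop) : P 0 -> P 1 -> forall i, P i.
Proof.
move=> P0 P1 [[|[|//]] hi].
  by rewrite (_ : Ordinal hi = 0) //; apply: val_inj.
by rewrite (_ : Ordinal hi = 1) //; apply: val_inj.
Qed.

Fact u2_coordK A : u2_mx (u2_coord A) = A.
Proof.
case: A => A hA; have /eqP/matrixP sA : map_mx conjc A^T == - A := hA.
have := (sA 0 0, sA 1 1, sA 0 1); rewrite !mxE => -[[h0 h1] h01].
apply/matrixP; apply: ord2_cases; apply: ord2_cases; rewrite !mxE /=; move: h0 h1 h01.
all: case: (A 0 0) => a0 b0; case: (A 1 1) => a1 b1.
all: case: (A 1 0) => a2 b2; case: (A 0 1) => a3 b3 /=.
all: move=> [/eqP h0] [/eqP h1] [h2 h3].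
all: move: h0 h1; rewrite -addr_eq0 -mulr2n -addr_eq0 -mulr2n !mulrn_eq0 /=.
all: move=> /eqP h0 /eqP h1; rewrite ?h0 ?h1 //.
by rewrite h2 (oppr_inj h3).
Qed.

Fact u2_coord_bij : bijective u2_coord.
Proof.
exists (fun v => U2 (u2_mx_skew v)) => [A|v]; first exact/val_inj/u2_coordK.
apply/rowP => i; rewrite !mxE.
by case: i => -[|[|[|[|//]]]] ? /=; rewrite ?mxE /=; congr (v _ _); apply: val_inj.
Qed.
Fact u2_vect_iso : Vector.axiom 4 u2.
Proof. by exists u2_coord; [exact: u2_coord_linear | exact: u2_coord_bij]. Qed.
HB.instance Definition _ := Lmodule_hasFinDim.Build R u2 u2_vect_iso.

Fact lie_subproof (A B : u2) :
  (A : 'M[C]_2) *m B - (B : 'M[C]_2) *m A \in skew_hermitian.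
Proof.
case: A => A hA; case: B => B hB /=; rewrite inE.
have /eqP sA : map_mx conjc A^T == - A := hA.
have /eqP sB : map_mx conjc B^T == - B := hB.
rewrite raddfB map_mxB /= !trmx_mul !map_mxM /= sA sB.
by rewrite !mulNmx !mulmxN !opprK opprB.
Qed.
Definition lie A B : u2 := U2 (lie_subproof A B).

End LieAlgebraU2.

Notation "[ 'L' x , y ]" := (lie x y) (format "[ 'L'  x ,  y ]") : ring_scope.

Section LeftInvariantTensors.
Variable R : realType.
Local Notation g := (u2 R).
Implicit Types (x y z : g) (alpha lambda : g -> R) (omega m : g -> g -> R).

(* The adapted bases (e_0, e_1, e_2, e_3) of u(2) = R e_0 + su(2). The vector
   e_0 is an arbitrary nonzero central element: it is not normalized. *)
Definition u2_frame (e : 4.-tuple g) : Prop :=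
  [/\ basis_of fullv e,
      forall x, [L e`_0, x] = 0,
      forall k : nat, (0 < k < 4)%N -> \tr (u2val e`_k) = 0
    & [/\ [L e`_1, e`_2] = - e`_3, [L e`_2, e`_3] = - e`_1
        & [L e`_3, e`_1] = - e`_2]].

Definition dual (e : 4.-tuple g) (k : nat) : g -> R := coord e (inord k).

(* Chevalley-Eilenberg formulas: the exterior differential of left-invariant
   1-forms and 2-forms. *)
Definition d1 alpha x y : R := - alpha [L x, y].
Definition d2 omega x y z : R :=
  - omega [L x, y] z + omega [L x, z] y - omega [L y, z] x.

Definition wedge11 alpha beta x y : R := alpha x * beta y - alpha y * beta x.
Definition wedge12 alpha omega x y z : R :=
  alpha x * omega y z + alpha y * omega z x + alpha z * omega x y.

Definition scale_form (s : R) omega x y : R := s * omega x y.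

Definition two_form omega : Prop :=
  bilinear_for *%R *%R omega /\ forall x, omega x x = 0.

Definition nondegenerate2 omega : Prop :=
  forall x, (forall y, omega x y = 0) -> x = 0.

Definition lee_form omega lambda : Prop :=
  [/\ scalar lambda, forall x y, d1 lambda x y = 0
    & forall x y z, d2 omega x y z = wedge12 lambda omega x y z].

Definition lcs omega : Prop :=
  [/\ two_form omega, nondegenerate2 omega & exists lambda, lee_form omega lambda].

Definition integrable_complex_structure (J : 'End(g)) : Prop :=
  (forall x, J (J x) = - x) /\
  (forall x y, [L J x, J y] - J [L J x, y] - J [L x, J y] - [L x, y] = 0).

Definition lc_pseudo_kahler omega (J : 'End(g)) : Prop :=
  [/\ lcs omega, integrable_complex_structure J
    & forall x y, omega (J x) y = - omega x (J y)].

Definition metric omega (J : 'End(g)) x y : R := omega x (J y).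

Definition definite m : Prop :=
  (forall x, x != 0 -> 0 < m x x) \/ (forall x, x != 0 -> m x x < 0).
Definition indefinite m : Prop := exists x y, 0 < m x x /\ m y y < 0.

(* A left-invariant metric has a left-invariant Levi-Civita connection, given
   on left-invariant vector fields by a bilinear map [nabla]. *)
Definition levi_civita m (nabla : g -> g -> g) : Prop :=
  [/\ bilinear_for *:%R *:%R nabla,
      forall x y, nabla x y - nabla y x = [L x, y]
    & forall x y z, m (nabla x y) z + m y (nabla x z) = 0].

Definition lee_field m lambda xi : Prop := forall y, m xi y = - (1 / 2) * lambda y.

Definition unit_parallel_lee_field omega J : Prop :=
  exists lambda xi nabla,
    [/\ lee_form omega lambda, lee_field (metric omega J) lambda xi,
        levi_civita (metric omega J) nabla, forall x, nabla x xi = 0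
      & metric omega J xi xi = 1].

(* The unit length is a normalization: rescaling [omega] by [s], of either sign,
   preserves [lambda] and multiplies the squared length of [xi] by [s^-1]. *)
Definition vaisman_type omega J : Prop :=
  lc_pseudo_kahler omega J /\
  exists2 s : R, s != 0 & unit_parallel_lee_field (scale_form s omega) J.

Definition std_form (e : 4.-tuple g) x y : R :=
  wedge11 (dual e 0) (dual e 1) x y + wedge11 (dual e 2) (dual e 3) x y.

(* The Lee form of a left-invariant lcs structure on U(2) is a nonzero multiple
   of e^0, so it is equal to -e^0 for exactly one choice of the central vector
   e_0. This normalization of e_0 relative to [omega] cannot be dropped once J is
   written in terms of e_0: for every s != 0 the form e^01 + s e^23 is lcs, with
   Lee form -s^-1 e^0, and is compatible with every J_{a,b}. *)
Definition lcs_adapted (e : 4.-tuple g) omega : Prop :=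
  lcs omega /\ lee_form omega (fun x => - dual e 0 x).

End LeftInvariantTensors.

(* Main.v *)
Require Import Defs.
From mathcomp Require Import all_boot all_order all_algebra.
From mathcomp Require Import complex reals boolp ring lra.

Set Implicit Arguments.
Unset Strict Implicit.
Unset Printing Implicit Defensive.

Import Order.TTheory GRing.Theory Num.Theory.
Local Open Scope ring_scope.

(** In the coframe the computation is linear algebra.  A Lee form [-e^0] forces
    [omega] to be closed for the twisted differential
    [d_lambda = d - lambda /\], and evaluating this on the triples
    [(e_0, e_i, e_j)] gives [omega = d_lambda alpha] with
    [alpha = p e^1 + q e^2 + r e^3], that is
    [p (e^01 + e^23) + q (e^02 + e^31) + r (e^03 + e^12)].  Such a self-dual
    form is non-degenerate as soon as [(p, q, r) <> 0], so the adapted lcs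
    structures are exactly these ([lcs_adaptedP]).

    The complex structure preserves the planes [span(e_0, e_1)] and
    [span(e_2, e_3)].  Compatibility constrains only the part [(q, r)] of
    [omega] that mixes them: it must be killed by a matrix of determinant
    [a^2 + (b - 1)^2] ([twisted_J_skewP]).  This is the dichotomy between
    [(a, b) <> (0, 1)], where only multiples of the standard form survive, and
    [(a, b) = (0, 1)], where every adapted form is compatible.

    For [s] times the standard form the metric is an orthogonal sum of definite
    forms, with the sign of [s b] on [span(e_0, e_1)] and of [- s] on
    [span(e_2, e_3)]; so it is definite exactly when [b < 0].  Its Lee field
    lies in [span(e_0, e_1)], so the adjoint action of the Lee field is an
    infinitesimal rotation of [span(e_2, e_3)], and the explicit Levi-Civita
    connection shows that the field is parallel ([std_vaisman]).  Conversely, a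
    parallel field has a skew-symmetric adjoint action, and in the case
    [(a, b) = (0, 1)] this is incompatible with [(q, r) <> 0]
    ([exceptional_vaisman]). *)

(** * Brackets and parallel fields *)

Lemma funext2 (S T U : Type) (f g : S -> T -> U) : f =2 g -> f = g.
Proof. by move=> fg; apply/funext => x; apply/funext => y. Qed.

Section LieBracket.
Variable R : realType.
Implicit Types x y z : u2 R.

Lemma lieC x y : [L y, x] = - [L x, y].
Proof. by apply: val_inj; rewrite /= opprB. Qed.

Lemma lie_linear_l z : linear (fun x => [L x, z]).
Proof.
move=> r x y; apply: val_inj => /=.
by rewrite mulmxDl mulmxDr -scalemxAl -scalemxAr scalerBr opprD addrACA.
Qed.

Lemma lieDl x y z : [L x + y, z] = [L x, z] + [L y, z].
Proof. by have := lie_linear_l z 1 x y; rewrite !scale1r. Qed.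

Lemma lie0l z : [L 0, z] = 0.
Proof. by apply: (addrI [L 0, z]); rewrite -lieDl !addr0. Qed.

Lemma lieZl r x z : [L r *: x, z] = r *: [L x, z].
Proof. by have := lie_linear_l z r x 0; rewrite lie0l !addr0. Qed.

Lemma lieDr x y z : [L z, x + y] = [L z, x] + [L z, y].
Proof. by rewrite lieC lieDl opprD -!(lieC _ z). Qed.

Lemma lieZr r x z : [L z, r *: x] = r *: [L z, x].
Proof. by rewrite lieC lieZl -scalerN -(lieC _ z). Qed.

End LieBracket.

(** Torsion-freeness turns [nabla_xi y] into [[xi, y]] when [xi] is parallel, so
    that metric compatibility in the direction [xi] says that [ad xi] is
    skew-symmetric. *)
Lemma parallel_killing (R : realType) (m : u2 R -> u2 R -> R) nabla xi :
  levi_civita m nabla -> (forall x, nabla x xi = 0) ->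
  forall y z, m [L xi, y] z + m y [L xi, z] = 0.
Proof.
case=> _ torsion compat par y z.
by rewrite -!torsion !par !subr0 compat.
Qed.

(** * The algebra in an adapted coframe *)

Section Frame.
Variables (R : realType) (e : 4.-tuple (u2 R)).
Hypothesis he : u2_frame e.
Local Notation e0 := (e`_0).
Local Notation e1 := (e`_1).
Local Notation e2 := (e`_2).
Local Notation e3 := (e`_3).
Local Notation th0 := (dual e 0).
Local Notation th1 := (dual e 1).
Local Notation th2 := (dual e 2).
Local Notation th3 := (dual e 3).
Implicit Types (x y z : u2 R) (p q r s : R).

Definition frame_vec p q r s : u2 R := p *: e0 + q *: e1 + r *: e2 + s *: e3.

Lemma frame_expand x : frame_vec (th0 x) (th1 x) (th2 x) (th3 x) = x.
Proof.
case: he => be _ _ _.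
have sumE : x = \sum_(i < 4) dual e i x *: e`_i.
  rewrite [LHS](coord_basis be (memvf x)); apply: eq_bigr => i _.
  by rewrite /dual inord_val.
by rewrite [RHS]sumE !big_ord_recr big_ord0 /= add0r.
Qed.

Lemma dual_frame i j : (i < 4)%N -> (j < 4)%N -> dual e i e`_j = (i == j)%:R.
Proof.
case: he => /basis_free fe _ _ _ hi hj.
rewrite /dual -[j in e`_j](inordK hj) coord_free // -val_eqE /= !inordK //.
by rewrite eq_sym.
Qed.

Lemma dualD k x y : dual e k (x + y) = dual e k x + dual e k y.
Proof. exact: raddfD. Qed.
Lemma dualN k x : dual e k (- x) = - dual e k x.
Proof. exact: raddfN. Qed.
Lemma dualZ k r x : dual e k (r *: x) = r * dual e k x.
Proof. by rewrite /dual linearZ. Qed.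
Lemma dual0 k : dual e k 0 = 0.
Proof. exact: raddf0. Qed.

Lemma dual_frame_vecE :
  (forall p q r s, th0 (frame_vec p q r s) = p) *
  (forall p q r s, th1 (frame_vec p q r s) = q) *
  (forall p q r s, th2 (frame_vec p q r s) = r) *
  (forall p q r s, th3 (frame_vec p q r s) = s).
Proof.
by do !split; move=> p q r s;
  rewrite /frame_vec !(dualD, dualZ) !dual_frame //=; ring.
Qed.

Lemma frame_neq0 i : (i < 4)%N -> e`_i != 0.
Proof.
move=> hi; apply/eqP => ei0; have := dual_frame hi hi.
by rewrite ei0 dual0 eqxx => /eqP; rewrite eq_sym oner_eq0.
Qed.

Lemma dual_inj x y :
  th0 x = th0 y -> th1 x = th1 y -> th2 x = th2 y -> th3 x = th3 y -> x = y.
Proof.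
by move=> h0 h1 h2 h3; rewrite -[x]frame_expand h0 h1 h2 h3 frame_expand.
Qed.

Lemma lie_frame x y :
  [L x, y] = frame_vec 0 (th3 x * th2 y - th2 x * th3 y)
    (th1 x * th3 y - th3 x * th1 y) (th2 x * th1 y - th1 x * th2 y).
Proof.
have lieN (u v w : u2 R) : [L u, v] = - w -> [L v, u] = w.
  by move=> h; rewrite lieC h opprK.
have lie_xx (u : u2 R) : [L u, u] = 0.
  by apply: val_inj; rewrite /= subrr.
case: he => _ c0 _ [h12 h23 h31].
have h21 := lieN _ _ _ h12; have h32 := lieN _ _ _ h23.
have h13 := lieN _ _ _ h31.
have c0' u : [L u, e0] = 0 by rewrite lieC c0 oppr0.
rewrite -{1}[x]frame_expand -{1}[y]frame_expand /frame_vec.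
rewrite !(lieDl, lieZl, lieDr, lieZr) !c0 !c0' !lie_xx h12 h23 h31 h21 h32 h13.
apply: dual_inj; rewrite !(dualD, dualZ, dualN, dual0) !dual_frame //=; ring.
Qed.

Lemma scalar_form0 (f : u2 R -> R) : scalar f -> f 0 = 0.
Proof.
by move=> fl; have := fl (-1) 0 0; rewrite scaler0 addr0 mulN1r addNr.
Qed.

Lemma scalar_formN (f : u2 R -> R) x : scalar f -> f (- x) = - f x.
Proof.
by move=> fl; rewrite -[- x]addr0 -scaleN1r fl mulN1r scalar_form0 // addr0.
Qed.

Lemma scalar_frame (f : u2 R -> R) x : scalar f ->
  f x = th0 x * f e0 + th1 x * f e1 + th2 x * f e2 + th3 x * f e3.
Proof.
move=> fl; rewrite -{1}[x]frame_expand /frame_vec.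
have fZ r u : f (r *: u) = r * f u.
  by rewrite -[_ *: _]addr0 fl scalar_form0 // addr0.
by rewrite -[(_ + _ + _ + _ in LHS)]addrA addrC -!addrA !fl fZ; ring.
Qed.

Lemma two_form_antisym (omega : u2 R -> u2 R -> R) x y :
  two_form omega -> omega y x = - omega x y.
Proof.
case=> -[wl wr] alt; apply/eqP; rewrite -addr_eq0; apply/eqP.
have := alt (1 *: x + y); rewrite wl !wr !alt.
by rewrite /= !mul1r add0r addr0 addrC.
Qed.

Lemma two_form_frame (omega : u2 R -> u2 R -> R) x y : two_form omega ->
  omega x y =
    omega e0 e1 * wedge11 th0 th1 x y + omega e2 e3 * wedge11 th2 th3 x y +
    omega e0 e2 * wedge11 th0 th2 x y + omega e3 e1 * wedge11 th3 th1 x y +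
    omega e0 e3 * wedge11 th0 th3 x y + omega e1 e2 * wedge11 th1 th2 x y.
Proof.
move=> w2; have [[wl wr] alt] := w2.
rewrite (scalar_frame x (wl y)).
rewrite (scalar_frame y (wr e0)) (scalar_frame y (wr e1)).
rewrite (scalar_frame y (wr e2)) (scalar_frame y (wr e3)) !alt.
rewrite (two_form_antisym e0 e1) // (two_form_antisym e0 e2) //.
rewrite (two_form_antisym e0 e3) // (two_form_antisym e1 e2) //.
rewrite (two_form_antisym e2 e3) // (two_form_antisym e3 e1) //.
by rewrite /wedge11; ring.
Qed.

(** * Left-invariant lcs forms *)

(** The twisted differential [d alpha + e^0 /\ alpha] of
    [alpha = p e^1 + q e^2 + r e^3]. *)
Definition twisted_form p q r x y : R :=
  p * (wedge11 th0 th1 x y + wedge11 th2 th3 x y) +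
  q * (wedge11 th0 th2 x y + wedge11 th3 th1 x y) +
  r * (wedge11 th0 th3 x y + wedge11 th1 th2 x y).

Lemma twisted_form_std s : twisted_form s 0 0 = scale_form s (std_form e).
Proof. by apply: funext2 => x y; rewrite /twisted_form !mul0r !addr0. Qed.

Lemma scale_twisted_form s p q r :
  scale_form s (twisted_form p q r) = twisted_form (s * p) (s * q) (s * r).
Proof. by apply: funext2 => x y; rewrite /scale_form /twisted_form; ring. Qed.

Lemma twisted_two_form p q r : two_form (twisted_form p q r).
Proof.
split; first split.
- by move=> z k x y; rewrite /twisted_form /wedge11 !(dualD, dualZ) /=; ring.
- by move=> z k x y; rewrite /twisted_form /wedge11 !(dualD, dualZ) /=; ring.
- by move=> x; rewrite /twisted_form /wedge11; ring.
Qed.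

Lemma twisted_lee_form p q r : lee_form (twisted_form p q r) (fun x => - th0 x).
Proof.
split.
- by move=> k x y; rewrite dualD dualZ opprD mulrN.
- by move=> x y; rewrite /d1 lie_frame dual_frame_vecE !oppr0.
- move=> x y z; rewrite /d2 /wedge12 /twisted_form /wedge11.
  by rewrite !lie_frame !dual_frame_vecE; ring.
Qed.

(** With [n = p^2 + q^2 + r^2], the matrix [W] of the form satisfies
    [W W^T = n I]: it is the action of an imaginary quaternion of squared norm
    [n].  So pairing [x] with the vector of coordinates [W^T e_k] returns [n]
    times the [k]-th coordinate of [x]. *)
Lemma twisted_nondegenerate p q r :
  p ^+ 2 + q ^+ 2 + r ^+ 2 != 0 -> nondegenerate2 (twisted_form p q r).
Proof.
move=> n0 x x0; set n := _ + _ in n0.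
have kill k u : n * dual e k x = twisted_form p q r x u ->
    dual e k x = dual e k 0.
  by rewrite x0 dual0 => /eqP; rewrite mulf_eq0 (negbTE n0) /= => /eqP.
apply: dual_inj.
- apply: (kill _ (frame_vec 0 p q r)).
  by rewrite /twisted_form /wedge11 !dual_frame_vecE /n; ring.
- apply: (kill _ (frame_vec (- p) 0 r (- q))).
  by rewrite /twisted_form /wedge11 !dual_frame_vecE /n; ring.
- apply: (kill _ (frame_vec (- q) (- r) 0 p)).
  by rewrite /twisted_form /wedge11 !dual_frame_vecE /n; ring.
- apply: (kill _ (frame_vec (- r) q (- p) 0)).
  by rewrite /twisted_form /wedge11 !dual_frame_vecE /n; ring.
Qed.

(** On [(e_0, e_i, e_j)] only the bracket [[e_i, e_j] = - e_k] contributes to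
    [d omega], and only [omega(e_i, e_j)] to the wedge product; comparing them
    gives [omega(e_i, e_j) = omega(e_0, e_k)]. *)
Lemma lcs_adaptedP omega : lcs_adapted e omega <->
  exists p q r, p ^+ 2 + q ^+ 2 + r ^+ 2 != 0 /\ omega = twisted_form p q r.
Proof.
split=> [[[w2 nd _] [_ _ lee]]|[p [q [r [n0 ->]]]]]; last first.
  split; last exact: twisted_lee_form.
  split; [exact: twisted_two_form|exact: twisted_nondegenerate|].
  by eexists; exact: twisted_lee_form.
have [[wl wr] alt] := w2.
case: he => _ c0 _ [h12 h23 h31].
have w0 u : omega 0 u = 0 by exact: scalar_form0 (wl u).
have wN u v : omega (- u) v = - omega u v by exact: scalar_formN (wl v).
have self_dual i j k : (0 < i < 4)%N -> (0 < j < 4)%N ->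
    [L e`_i, e`_j] = - e`_k -> omega e`_i e`_j = omega e0 e`_k.
  move=> /andP[i0 i4] /andP[j0 j4] hij; have := lee e0 e`_i e`_j.
  rewrite /d2 /wedge12 !c0 !w0 hij wN !dual_frame //.
  by rewrite (ltn_eqF i0) (ltn_eqF j0) (two_form_antisym e0 e`_k w2) /=; lra.
exists (omega e0 e1), (omega e0 e2), (omega e0 e3).
have wE : omega = twisted_form (omega e0 e1) (omega e0 e2) (omega e0 e3).
  apply: funext2 => x y; rewrite [LHS]two_form_frame //.
  rewrite (self_dual 2 3 1) // (self_dual 3 1 2) // (self_dual 1 2 3) //.
  by rewrite /twisted_form; ring.
split=> //; apply/negP => /eqP n0.
suff e00 : e0 = 0 by have := frame_neq0 (isT : (0 < 4)%N); rewrite e00 eqxx.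
apply: nd => y; rewrite wE.
have p0 : omega e0 e1 = 0 by nra.
have q0 : omega e0 e2 = 0 by nra.
have r0 : omega e0 e3 = 0 by nra.
by rewrite p0 q0 r0 /twisted_form !mul0r !addr0.
Qed.

(** A closed form vanishes on brackets, and [su(2)] is spanned by brackets. *)
Lemma closed_su2 omega lambda : lee_form omega lambda ->
  [/\ lambda e1 = 0, lambda e2 = 0 & lambda e3 = 0].
Proof.
case=> lambda_lin closed _.
have lambda0 u v w : [L u, v] = - w -> lambda w = 0.
  move=> huv; have := closed u v.
  by rewrite /d1 huv scalar_formN // opprK.
by case: he => _ _ _ [h12 h23 h31]; split; apply: lambda0; eassumption.
Qed.

(** * The complex structures J_{a,b} *)

Section ComplexStructure.
Variables (a b c : R) (J : 'End(u2 R)).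
Hypotheses (hb : b != 0) (hc : c = - ((1 + a ^+ 2) / b)).
Hypotheses (hJ0 : J e0 = a *: e0 + b *: e1) (hJ1 : J e1 = c *: e0 - a *: e1).
Hypotheses (hJ2 : J e2 = - e3) (hJ3 : J e3 = e2).

Lemma mulbc : b * c = - (1 + a ^+ 2).
Proof. by rewrite hc; field. Qed.

Lemma J_frame x :
  J x = frame_vec (a * th0 x + c * th1 x) (b * th0 x - a * th1 x)
    (th3 x) (- th2 x).
Proof.
rewrite -{1}[x]frame_expand /frame_vec !linearD !linearZ /= hJ0 hJ1 hJ2 hJ3.
by apply: dual_inj; rewrite !(dualD, dualZ, dualN) !dual_frame //=; ring.
Qed.

Lemma J_integrable : integrable_complex_structure J.
Proof.
split=> [x|x y].
  have bc := mulbc.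
  by apply: dual_inj; rewrite dualN !J_frame !dual_frame_vecE; ring: bc.
by apply: dual_inj;
  rewrite !(dualD, dualN) !J_frame !lie_frame !dual_frame_vecE dual0; ring.
Qed.

(** On each of the [J]-invariant planes [span(e_0, e_1)] and [span(e_2, e_3)]
    every 2-form is compatible with [J].  On the pairs [(e_2, e_0)] and
    [(e_3, e_0)] compatibility says that [(q, r)] is in the kernel of the
    scaled rotation with rows [(a, b - 1)] and [(1 - b, a)], of determinant
    [a^2 + (b - 1)^2]. *)
Lemma twisted_J_skewP p q r :
  (forall x y, twisted_form p q r (J x) y = - twisted_form p q r x (J y)) <->
  (q = 0 /\ r = 0) \/ (a = 0 /\ b = 1).
Proof.
split=> [skew|]; last first.
  have bc := mulbc.
  case=> [[-> ->]|[a0 b1]] x y;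
    rewrite /twisted_form /wedge11 !J_frame !dual_frame_vecE; first by ring.
  by rewrite hc a0 b1; field.
have [hr hq] : a * r = (b - 1) * q /\ a * q = (1 - b) * r.
  have := skew e2 e0; have := skew e3 e0.
  rewrite /twisted_form /wedge11 !J_frame !dual_frame_vecE !dual_frame //=.
  by move=> h1 h2; split; lra.
have nq : (a ^+ 2 + (b - 1) ^+ 2) * q = 0.
  transitivity (a * (a * q) - (1 - b) * ((b - 1) * q)); first by ring.
  by rewrite hq -hr; ring.
have nr : (a ^+ 2 + (b - 1) ^+ 2) * r = 0.
  transitivity (a * (a * r) - (b - 1) * ((1 - b) * r)); first by ring.
  by rewrite hr -hq; ring.
have [/eqP|n0] := eqVneq (a ^+ 2 + (b - 1) ^+ 2) 0.
  rewrite paddr_eq0 ?sqr_ge0 // !sqrf_eq0 subr_eq0 => /andP[/eqP a0 /eqP b1].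
  by right.
by left; split; apply: (mulfI n0); rewrite mulr0.
Qed.

Lemma twisted_lc_pseudo_kahler p q r :
  p ^+ 2 + q ^+ 2 + r ^+ 2 != 0 -> (q = 0 /\ r = 0) \/ (a = 0 /\ b = 1) ->
  lc_pseudo_kahler (twisted_form p q r) J.
Proof.
move=> n0 qr; split; [|exact: J_integrable|exact/twisted_J_skewP].
by have [|//] := proj2 (lcs_adaptedP (twisted_form p q r)); exists p, q, r.
Qed.

(** * Multiples of the standard form *)

(** The Levi-Civita connection given by the Koszul formula for the standard
    form; it does not change when the metric is multiplied by a constant. *)
Definition std_connection x y : u2 R :=
  frame_vec 0 ((th3 x * th2 y - th2 x * th3 y) / 2)
    ((1 - c / 2) * th1 x * th3 y - c / 2 * th3 x * th1 y
       - a / 2 * (th0 x * th3 y + th3 x * th0 y))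
    ((c / 2 - 1) * th1 x * th2 y + c / 2 * th2 x * th1 y
       + a / 2 * (th0 x * th2 y + th2 x * th0 y)).

Lemma std_levi_civita s :
  levi_civita (metric (twisted_form s 0 0) J) std_connection.
Proof.
split.
- by split=> z k x y; apply: dual_inj;
    rewrite /= /std_connection !(dual_frame_vecE, dualD, dualZ); ring.
- by move=> x y; apply: dual_inj;
    rewrite lie_frame /std_connection !(dual_frame_vecE, dualD, dualN); field.
- move=> x y z; rewrite /metric /std_connection /twisted_form /wedge11 !J_frame.
  by rewrite !dual_frame_vecE; field.
Qed.

(** For the multiple [t] of the standard form, the Lee field is
    [- 1 / (2 t) (c e_0 - a e_1)] and has squared length [- c / (4 t)].  The
    normalization to unit length is thus [t = - c / 4], which makes the Lee
    field [2 e_0 - (2 a / c) e_1]. *)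
Lemma std_vaisman s : s != 0 -> vaisman_type (twisted_form s 0 0) J.
Proof.
move=> s0; split.
  apply: twisted_lc_pseudo_kahler; last by left.
  by rewrite expr0n /= !addr0 expf_eq0.
have bc := mulbc.
have c0 : c != 0 by apply/eqP => c0; move: bc; rewrite c0; nra.
exists (- c / 4 / s).
  by rewrite !mulf_neq0 ?invr_eq0 ?oppr_eq0 ?pnatr_eq0.
rewrite scale_twisted_form !mulr0 (_ : _ * s = - c / 4); last by field.
exists (fun x => - th0 x), (frame_vec 2 (- (2 * a / c)) 0 0), std_connection.
split.
- exact: twisted_lee_form.
- move=> y; rewrite /metric /twisted_form /wedge11 !J_frame !dual_frame_vecE.
  by field: bc.
- exact: std_levi_civita.
- by move=> x; apply: dual_inj;
    rewrite /std_connection !dual_frame_vecE ?dual0; field.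
- rewrite /metric /twisted_form /wedge11 !J_frame !dual_frame_vecE.
  by field: bc.
Qed.

(** The values [s b] at [e_0] and [- s] at [e_2] have the same sign only if
    [b < 0].  Conversely, multiplying the quadratic form of the standard metric
    by [b] and completing the square, with [b c = - (1 + a^2)], gives a sum of
    squares with positive coefficients. *)
Lemma std_metric_definite s :
  s != 0 -> definite (metric (twisted_form s 0 0) J) <-> b < 0.
Proof.
move=> s0; have bc := mulbc.
have mE x : metric (twisted_form s 0 0) J x x =
    s * (b * th0 x ^+ 2 - 2 * a * th0 x * th1 x - c * th1 x ^+ 2
         - th2 x ^+ 2 - th3 x ^+ 2).
  by rewrite /metric /twisted_form /wedge11 !J_frame !dual_frame_vecE; ring.
have m0 : metric (twisted_form s 0 0) J e0 e0 = s * b.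
  by rewrite mE !dual_frame //=; ring.
have m2 : metric (twisted_form s 0 0) J e2 e2 = - s.
  by rewrite mE !dual_frame //=; ring.
split=> [[pos|neg]|b_lt0].
- have := pos _ (@frame_neq0 0 isT); have := pos _ (@frame_neq0 2 isT).
  by rewrite m0 m2 oppr_gt0 => s_lt0; rewrite nmulr_rgt0.
- have := neg _ (@frame_neq0 0 isT); have := neg _ (@frame_neq0 2 isT).
  by rewrite m0 m2 oppr_lt0 => s_gt0; rewrite pmulr_rlt0.
have quad_lt0 x : x != 0 ->
    b * th0 x ^+ 2 - 2 * a * th0 x * th1 x - c * th1 x ^+ 2
      - th2 x ^+ 2 - th3 x ^+ 2 < 0.
  move=> xn0; rewrite ltNge; apply: contra xn0.
  set Q := (X in 0 <= X) => Q_ge0.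
  have squares : b * Q = (b * th0 x - a * th1 x) ^+ 2 + th1 x ^+ 2
      + (- b) * th2 x ^+ 2 + (- b) * th3 x ^+ 2 by rewrite /Q; ring: bc.
  have bQ_le0 : b * Q <= 0 by rewrite nmulr_rle0.
  have nb : 0 < - b by rewrite oppr_gt0.
  have s01 := sqr_ge0 (b * th0 x - a * th1 x); have s1 := sqr_ge0 (th1 x).
  have s2 := mulr_ge0 (ltW nb) (sqr_ge0 (th2 x)).
  have s3 := mulr_ge0 (ltW nb) (sqr_ge0 (th3 x)).
  have x1 : th1 x = 0 by apply/eqP; rewrite -sqrf_eq0; apply/eqP; lra.
  have : b * th0 x - a * th1 x == 0 by rewrite -sqrf_eq0; apply/eqP; lra.
  rewrite x1 mulr0 subr0 mulf_eq0 (negbTE hb) /= => /eqP x0.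
  have : - b * th2 x ^+ 2 == 0 by apply/eqP; lra.
  rewrite mulf_eq0 (gt_eqF nb) sqrf_eq0 /= => /eqP x2.
  have : - b * th3 x ^+ 2 == 0 by apply/eqP; lra.
  rewrite mulf_eq0 (gt_eqF nb) sqrf_eq0 /= => /eqP x3.
  by apply/eqP/dual_inj; rewrite dual0.
have [s_gt0|s_lt0|s_eq0] := ltrgt0P s.
- by right=> x /quad_lt0 Qx; rewrite mE pmulr_rlt0.
- by left=> x /quad_lt0 Qx; rewrite mE nmulr_rgt0.
- by rewrite s_eq0 eqxx in s0.
Qed.

(** * The exceptional case a = 0, b = 1 *)

Lemma exceptional_metricE p q r x y : a = 0 -> b = 1 ->
  metric (twisted_form p q r) J x y =
    p * (th0 x * th0 y + th1 x * th1 y - th2 x * th2 y - th3 x * th3 y)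
    + q * (th1 x * th2 y + th2 x * th1 y + th0 x * th3 y + th3 x * th0 y)
    + r * (th1 x * th3 y + th3 x * th1 y - th0 x * th2 y - th2 x * th0 y).
Proof.
move=> a0 b1; rewrite /metric /twisted_form /wedge11 !J_frame !dual_frame_vecE.
by rewrite hc a0 b1; field.
Qed.

(** One of the planes spanned by [e_0, e_2], by [e_1, e_2] and by [e_1, e_3]
    has signature (1, 1), according to which of [p], [q], [r] is the first
    nonzero one. *)
Lemma exceptional_indefinite p q r : a = 0 -> b = 1 ->
  p ^+ 2 + q ^+ 2 + r ^+ 2 != 0 -> indefinite (metric (twisted_form p q r) J).
Proof.
move=> a0 b1 n0.
have opposite_values x y k : k != 0 ->
    metric (twisted_form p q r) J x x = k ->
    metric (twisted_form p q r) J y y = - k ->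
    indefinite (metric (twisted_form p q r) J).
  move=> k0 mx my; have [k_gt0|k_lt0] := ltP 0 k.
    by exists x, y; rewrite mx my oppr_lt0.
  by exists y, x; rewrite mx my oppr_gt0 !lt_neqAle k0 k_lt0.
have [p0|p0] := eqVneq p 0; last first.
  by apply: (opposite_values e0 e2 p) => //;
    rewrite exceptional_metricE // !dual_frame //=; ring.
have [q0|q0] := eqVneq q 0; last first.
  apply: (opposite_values (frame_vec 0 1 1 0) (frame_vec 0 1 (-1) 0) (2 * q)).
  - by rewrite mulf_neq0 ?pnatr_eq0.
  - by rewrite exceptional_metricE // !dual_frame_vecE p0; ring.
  - by rewrite exceptional_metricE // !dual_frame_vecE p0; ring.
have r0 : r != 0 by apply: contraNneq n0 => ->; rewrite p0 q0 expr0n /= !addr0.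
apply: (opposite_values (frame_vec 0 1 0 1) (frame_vec 0 1 0 (-1)) (2 * r)).
- by rewrite mulf_neq0 ?pnatr_eq0.
- by rewrite exceptional_metricE // !dual_frame_vecE p0; ring.
- by rewrite exceptional_metricE // !dual_frame_vecE p0; ring.
Qed.

(** A parallel Lee field [xi] has skew-symmetric adjoint action, and it is
    orthogonal to [su(2)] because the Lee form vanishes there.  When
    [(q, r) <> 0], evaluating the skewness on pairs of frame vectors kills the
    [su(2)]-part of [xi], and orthogonality then kills its central part; but
    [xi] has unit length. *)
Lemma exceptional_vaisman p q r : a = 0 -> b = 1 ->
  vaisman_type (twisted_form p q r) J -> q = 0 /\ r = 0.
Proof.
move=> a0 b1 [_ [s s0 [lambda [xi [nabla [lee xi_lee lc par unit_xi]]]]]].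
have killing := parallel_killing lc par.
have [_ lambda2 lambda3] := closed_su2 lee.
rewrite scale_twisted_form in xi_lee unit_xi killing.
suff nq : (s * q) ^+ 2 + (s * r) ^+ 2 = 0.
  move/eqP: nq; rewrite paddr_eq0 ?sqr_ge0 // !sqrf_eq0 !mulf_eq0 (negbTE s0).
  by case/andP => /eqP-> /eqP->.
apply/eqP; apply: contraT => n0.
move: (s * p) (s * q) (s * r) n0 xi_lee unit_xi killing => P Q T.
move=> n0 xi_lee unit_xi killing.
have mE x y := exceptional_metricE P Q T x y a0 b1.
have xi_e2 : Q * th1 xi - P * th2 xi - T * th0 xi = 0.
  by have := xi_lee e2; rewrite lambda2 mE !dual_frame //=; lra.
have xi_e3 : Q * th0 xi - P * th3 xi + T * th1 xi = 0.
  by have := xi_lee e3; rewrite lambda3 mE !dual_frame //=; lra.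
have Q1 : Q * th1 xi = 0.
  by have := killing e2 e0; rewrite !mE !lie_frame !dual_frame_vecE;
    rewrite !dual_frame //=; lra.
have T1 : T * th1 xi = 0.
  by have := killing e3 e0; rewrite !mE !lie_frame !dual_frame_vecE;
    rewrite !dual_frame //=; lra.
have Q2T3 : Q * th2 xi + T * th3 xi = 0.
  by have := killing e1 e0; rewrite !mE !lie_frame !dual_frame_vecE;
    rewrite !dual_frame //=; lra.
have Q3 : Q * th3 xi = 0.
  by have := killing e2 e2; rewrite !mE !lie_frame !dual_frame_vecE;
    rewrite !dual_frame //=; lra.
have T2 : T * th2 xi = 0.
  by have := killing e3 e3; rewrite !mE !lie_frame !dual_frame_vecE;
    rewrite !dual_frame //=; lra.
have cancel (t : R) : Q * t = 0 -> T * t = 0 -> t = 0.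
  move=> Qt Tt; apply: (mulfI n0).
  by transitivity (Q * (Q * t) + T * (T * t)); [ring|rewrite Qt Tt; ring].
have xi2 : th2 xi = 0.
  apply: (mulfI n0).
  transitivity (Q * (Q * th2 xi + T * th3 xi) - T * (Q * th3 xi)
                + T * (T * th2 xi)).
    by ring.
  by rewrite Q2T3 Q3 T2; ring.
have xi3 : th3 xi = 0 by apply: cancel => //; move: Q2T3; rewrite xi2; lra.
have xi1 : th1 xi = 0 by apply: cancel.
have xi0 : th0 xi = 0.
  by apply: cancel; move: xi_e2 xi_e3; rewrite xi1 xi2 xi3; lra.
by move: unit_xi; rewrite mE xi0 xi1 xi2 xi3; lra.
Qed.

End ComplexStructure.
End Frame.

(** * The theorem *)

Theorem theorem4p6 (R : realType) (e : 4.-tuple (u2 R)) (he : u2_frame e)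
    (a b c : R) (hb : b != 0) (hc : c = - ((1 + a ^+ 2) / b))
    (J : 'End(u2 R))
    (hJ0 : J e`_0 = a *: e`_0 + b *: e`_1)
    (hJ1 : J e`_1 = c *: e`_0 - a *: e`_1)
    (hJ2 : J e`_2 = - e`_3)
    (hJ3 : J e`_3 = e`_2) :
  ((a, b) <> (0, 1) ->
    (forall omega : u2 R -> u2 R -> R,
       lcs_adapted e omega /\ lc_pseudo_kahler omega J <->
       exists2 s : R, s != 0 & omega =2 scale_form s (std_form e)) /\
    (forall omega : u2 R -> u2 R -> R,
       lcs_adapted e omega -> lc_pseudo_kahler omega J ->
       vaisman_type omega J /\ (definite (metric omega J) <-> b < 0)))
  /\
  ((a, b) = (0, 1) ->
    forall omega : u2 R -> u2 R -> R, lcs_adapted e omega ->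
      [/\ lc_pseudo_kahler omega J,
          indefinite (metric omega J)
        & vaisman_type omega J <->
          exists s : R, omega =2 scale_form s (std_form e)]).
Proof.
have norm_s (s : R) : s != 0 -> s ^+ 2 + 0 ^+ 2 + 0 ^+ 2 != 0.
  by move=> s0; rewrite expr0n /= !addr0 expf_eq0.
split=> [ab|[a0 b1] omega /(lcs_adaptedP he)[p [q [r [n0 ->]]]]].
  have standard omega : lcs_adapted e omega -> lc_pseudo_kahler omega J ->
      exists2 s : R, s != 0 & omega = twisted_form e s 0 0.
    move=> /(lcs_adaptedP he)[p [q [r [n0 ->]]]] [_ _ skew].
    have skewP := twisted_J_skewP he hb hc hJ0 hJ1 hJ2 hJ3 p q r.
    have [[q0 r0]|[a0 b1]] := proj1 skewP skew; last by case: ab; rewrite a0 b1.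
    exists p; rewrite q0 r0 // in n0 *.
    by apply: contraNneq n0 => ->; rewrite expr0n /= !addr0.
  split=> omega.
    split=> [[adapted pk]|[s s0 /funext2 ->]].
      have [s s0 ->] := standard _ adapted pk.
      by exists s => //; rewrite twisted_form_std.
    rewrite -twisted_form_std; split.
      by apply/(lcs_adaptedP he); exists s, 0, 0; split=> //; exact: norm_s.
    apply: (twisted_lc_pseudo_kahler he hb hc hJ0 hJ1 hJ2 hJ3); last by left.
    exact: norm_s.
  move=> adapted pk; have [s s0 ->] := standard _ adapted pk.
  split; first exact: (std_vaisman he hb hc hJ0 hJ1 hJ2 hJ3).
  exact: (std_metric_definite he hb hc hJ0 hJ1 hJ2 hJ3).
split.
- by apply: (twisted_lc_pseudo_kahler he hb hc hJ0 hJ1 hJ2 hJ3) => //; right.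
- exact: (exceptional_indefinite he hc hJ0 hJ1 hJ2 hJ3).
- split=> [vais|[s /funext2 omegaE]].
    have [-> ->] := exceptional_vaisman he hc hJ0 hJ1 hJ2 hJ3 a0 b1 vais.
    by exists p; rewrite twisted_form_std.
  have s0 : s != 0.
    apply/eqP => s0; have [[_ nd _] _] : lcs_adapted e (twisted_form e p q r).
      by apply/(lcs_adaptedP he); exists p, q, r.
    have := frame_neq0 he (isT : (0 < 4)%N); rewrite (nd e`_0) ?eqxx // => y.
    by rewrite omegaE s0 /scale_form mul0r.
  rewrite omegaE -twisted_form_std.
  exact: (std_vaisman he hb hc hJ0 hJ1 hJ2 hJ3).
Qed.
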